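(* Let $\mathbb G$ be a group of Heisenberg type and let $\rho=(|z|^4+16|t|^2)^{1/4}$ in exponential coordinates. Given a ($C^1$) function $u:\mathbb G\to\mathbb R$, its discrepancy at $e$ is given, in $\mathbb G\setminus\{e\}$, by $$E_u=\langle\nabla_Hu,\nabla_H\rho\rangle-\frac{Zu}{\rho}|\nabla_H\rho|^2=\frac{4}{\rho^3}\sum_{\ell=1}^kt_\ell\,\Theta_\ell(u),\qquad \Theta_\ell=\sum_{i=1}^m\langle J(\varepsilon_\ell)z,e_i\rangle\,\partial_{z_i}.$$ As a consequence, in a group of Heisenberg type a function $u$ has vanishing discrepancy ($E_u\equiv0$) if and only if $$\sum_{\ell=1}^kt_\ell\,\Theta_\ell(u)\equiv0 .$$
   Context: $\mathbb G$ is a Carnot group of step two: a connected, simply connected Lie group with Lie algebra $\mathfrak g=V_1\oplus V_2$, $[V_1,V_1]=V_2$, $[V_1,V_2]=\{0\}$, $[V_2,V_2]=\{0\}$, with an inner product $\langle\cdot,\cdot\rangle$ on $\mathfrak g$ for which $V_1\perp V_2$; $\{e_1,\dots,e_m\}$ and $\{\varepsilon_1,\dots,\varepsilon_k\}$ are orthonormal bases of $V_1$ and $V_2$. The map $J:V_2\to\mathrm{End}(V_1)$ is defined by $\langle J(t)z,z'\rangle=\langle[z,z'],t\rangle$. $\mathbb G$ is of Heisenberg type if $J(t)$ is orthogonal for every $t\in V_2$ with $|t|=1$, equivalently $\langle J(t)z,J(t)z'\rangle=|t|^2\langle z,z'\rangle$. Exponential coordinates $(z,t)$ of $g\in\mathbb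 G$: $g=\exp(z+t)$ with $z=\sum z_ie_i\in V_1$, $t=\sum t_\ell\varepsilon_\ell\in V_2$; $e$ is the group identity. $X_i$ is the left-invariant vector field determined by $e_i$; in these coordinates $X_i=\partial_{z_i}+\frac12\sum_{\ell=1}^k\langle J(\varepsilon_\ell)z,e_i\rangle\partial_{t_\ell}$. $\langle\nabla_Hu,\nabla_Hv\rangle=\sum_{i=1}^mX_iu\,X_iv$, $|\nabla_Hu|^2=\sum_i(X_iu)^2$. $Z=\sum_iz_i\partial_{z_i}+2\sum_\ell t_\ell\partial_{t_\ell}$ is the infinitesimal generator of the dilations $\delta_\lambda(z,t)=(\lambda z,\lambda^2t)$. *)

(* Defs.v *)
From HB Require Import structures.
From mathcomp Require Import all_boot all_order all_algebra.
From mathcomp Require Import all_classical all_reals all_analysis.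

Set Implicit Arguments.
Unset Strict Implicit.
Unset Printing Implicit Defensive.
Import Order.TTheory GRing.Theory Num.Theory.
Import numFieldNormedType.Exports.
Local Open Scope classical_set_scope.
Local Open Scope ring_scope.

(* The library norm `|z| on 'rV[R]_n is the sup norm, so the Euclidean inner
   product and norm are defined here. *)
Definition dot {R : realType} {n : nat} (x y : 'rV[R]_n) : R :=
  \sum_(i < n) x 0 i * y 0 i.

Definition enorm {R : realType} {n : nat} (x : 'rV[R]_n) : R :=
  Num.sqrt (dot x x).

(* V_1 (+) V_2 with V_1 = R^m and V_2 = R^k through the orthonormal bases
   e_1, ..., e_m and eps_1, ..., eps_k (the standard bases).  Points of the
   group are written in exponential coordinates (z, t), so this is also the
   carrier of the group, and the exponential map is the identity. *)
Notation strat R m k := ('rV[R]_m * 'rV[R]_k)%type.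

Section Stratification.
Context {R : realType} {m k : nat}.

Definition V1 : set (strat R m k) := [set x | x.2 = 0].
Definition V2 : set (strat R m k) := [set x | x.1 = 0].

Definition e1 (i : 'I_m) : strat R m k := (delta_mx 0 i, 0).
Definition e2 (l : 'I_k) : strat R m k := (0, delta_mx 0 l).

(* The linear span of {[a, b] | a in A, b in B} when A is a subspace and the
   bracket is linear in a: scalars are absorbed into a. *)
Definition brackets (br : strat R m k -> strat R m k -> strat R m k)
    (A B : set (strat R m k)) : set (strat R m k) :=
  [set x | exists n (a b : 'I_n -> strat R m k),
    [/\ forall i, A (a i), forall i, B (b i) & x = \sum_(i < n) br (a i) (b i)]].

End Stratification.

(* The field carnot_V2_neq0 says that V_2 <> {0}: the step is exactly two. *)
Record carnot2 (R : realType) (m k : nat) := Carnot2 {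
  lie :> strat R m k -> strat R m k -> strat R m k;
  lie_linearl : forall a x y z, lie (a *: x + y) z = a *: lie x z + lie y z;
  lie_linearr : forall a x y z, lie z (a *: x + y) = a *: lie z x + lie z y;
  lie_alt : forall x, lie x x = 0;
  lie_jacobi : forall x y z,
    lie x (lie y z) + lie y (lie z x) + lie z (lie x y) = 0;
  carnot_V1V1 : brackets lie V1 V1 = V2;
  carnot_V1V2 : brackets lie V1 V2 = [set 0];
  carnot_V2V2 : brackets lie V2 V2 = [set 0];
  carnot_V2_neq0 : (0 < k)%N
}.

Section Carnot.
Context {R : realType} {m k : nat} (G : carnot2 R m k).
Implicit Types (g h x y z : strat R m k) (u : strat R m k -> R).

(* Baker-Campbell-Hausdorff, which stops at the first bracket in step two. *)
Definition gmul g h : strat R m k := g + h + 2^-1 *: lie G g h.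
Definition gid : strat R m k := 0.

(* The row vector of the numbers <[z, e_i], t>; J_adj below is the defining
   property <J(t) z, z'> = <[z, z'], t>. *)
Definition J (t : 'rV[R]_k) (z : 'rV[R]_m) : 'rV[R]_m :=
  \row_(i < m) dot (lie G (z, 0) (e1 i)).2 t.

Definition Heisenberg_type : Prop :=
  forall t : 'rV[R]_k, enorm t = 1 ->
  forall z z' : 'rV[R]_m, dot (J t z) (J t z') = dot z z'.

(* The derivative at s = 0 of u (g * exp (s e_i)); X_coord below is the
   formula in exponential coordinates. *)
Definition X (i : 'I_m) u g : R := 'D_(e1 i) (fun h => u (gmul g h)) gid.

Definition gradH u g : 'rV[R]_m := \row_(i < m) X i u g.

Definition partial_z (i : 'I_m) u g : R := 'D_(e1 i) u g.
Definition partial_t (l : 'I_k) u g : R := 'D_(e2 l) u g.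

Definition Z u g : R :=
  \sum_(i < m) g.1 0 i * partial_z i u g
  + 2 * \sum_(l < k) g.2 0 l * partial_t l u g.

Definition rho g : R := (enorm g.1 ^+ 4 + 16 * enorm g.2 ^+ 2) `^ (4^-1).

(* The discrepancy of u at the identity; it is meant for g != gid only. *)
Definition discrepancy u g : R :=
  dot (gradH u g) (gradH rho g) - Z u g / rho g * enorm (gradH rho g) ^+ 2.

Definition Theta (l : 'I_k) u g : R :=
  \sum_(i < m) J (delta_mx 0 l) g.1 0 i * partial_z i u g.

Definition C1 u : Prop :=
  (forall g, differentiable u g) /\ (forall w : strat R m k, continuous (fun g => 'd u g w)).

Lemma lie0r x : lie G x 0 = 0.
Proof.
have := lie_linearr G 1 0 0 x; rewrite !scale1r addr0 => /eqP.
by rewrite -subr_eq0 opprD addrA subrr sub0r oppr_eq0 => /eqP.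
Qed.

Lemma lieZr a x y : lie G x (a *: y) = a *: lie G x y.
Proof. by rewrite -[a *: y]addr0 lie_linearr lie0r addr0. Qed.

Lemma lieDr x y z : lie G x (y + z) = lie G x y + lie G x z.
Proof. by rewrite -[y]scale1r lie_linearr !scale1r. Qed.

Lemma lie_sumr x n (f : 'I_n -> strat R m k) :
  lie G x (\sum_(i < n) f i) = \sum_(i < n) lie G x (f i).
Proof.
apply: (big_morph (lie G x)); [exact: lieDr | exact: lie0r].
Qed.

Lemma lie_V1V1 x y : V1 x -> V1 y -> (lie G x y).1 = 0.
Proof.
move=> xV yV; suff : V2 (lie G x y) by [].
rewrite -(carnot_V1V1 G); exists 1%N, (fun=> x), (fun=> y).
by split=> //; rewrite big_ord_recr big_ord0 /= add0r.
Qed.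

Lemma lie_V1V2 x y : V1 x -> V2 y -> lie G x y = 0.
Proof.
move=> xV yV; suff : [set 0] (lie G x y) by [].
rewrite -(carnot_V1V2 G); exists 1%N, (fun=> x), (fun=> y).
by split=> //; rewrite big_ord_recr big_ord0 /= add0r.
Qed.

Lemma lie_V2V2 x y : V2 x -> V2 y -> lie G x y = 0.
Proof.
move=> xV yV; suff : [set 0] (lie G x y) by [].
rewrite -(carnot_V2V2 G); exists 1%N, (fun=> x), (fun=> y).
by split=> //; rewrite big_ord_recr big_ord0 /= add0r.
Qed.

Lemma lie0l x : lie G 0 x = 0.
Proof.
have := lie_linearl G 1 0 0 x; rewrite !scale1r addr0 => /eqP.
by rewrite -subr_eq0 opprD addrA subrr sub0r oppr_eq0 => /eqP.
Qed.

Lemma lieDl x y z : lie G (x + y) z = lie G x z + lie G y z.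
Proof. by rewrite -[x]scale1r lie_linearl !scale1r. Qed.

Lemma lieN x y : lie G y x = - lie G x y.
Proof.
have := lie_alt G (x + y).
rewrite lieDl !lieDr !lie_alt add0r addr0 => /eqP.
by rewrite addrC addr_eq0 => /eqP.
Qed.

Lemma strat_split x : x = (x.1, 0) + (0, x.2).
Proof. by case: x => z t; congr pair => /=; rewrite ?addr0 ?add0r. Qed.

Lemma lie_V1 x y : lie G x y = lie G (x.1, 0) (y.1, 0).
Proof.
rewrite {1}(strat_split x) {1}(strat_split y) lieDl !lieDr.
rewrite [lie G (x.1, 0) (0, y.2)]lie_V1V2 // [lie G (0, _) (y.1, 0)]lieN.
rewrite [lie G (y.1, 0) (0, x.2)]lie_V1V2 // [lie G (0, x.2) _]lie_V2V2 //.
by rewrite oppr0 !addr0.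
Qed.

Lemma gmul1g g : gmul gid g = g.
Proof. by rewrite /gmul lie0l scaler0 addr0 add0r. Qed.

Lemma gmulg1 g : gmul g gid = g.
Proof. by rewrite /gmul lie0r scaler0 !addr0. Qed.

Lemma gmulgV g : gmul g (- g) = gid.
Proof. by rewrite /gmul -scaleN1r lieZr lie_alt !scaler0 addr0 scaleN1r subrr. Qed.

Lemma lie_lier x y z : lie G x (lie G y z) = 0.
Proof.
rewrite lie_V1 (_ : (lie G y z).1 = 0) ?lie0r //.
by rewrite (lie_V1 y z) lie_V1V1.
Qed.

Lemma gmulA g h x : gmul g (gmul h x) = gmul (gmul g h) x.
Proof.
have lie_liel y z w : lie G (lie G y z) w = 0 by rewrite lieN lie_lier oppr0.
have lieZl a y z : lie G (a *: y) z = a *: lie G y z.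
  by rewrite lieN lieZr -scalerN -lieN.
rewrite /gmul !(lieDr, lieDl, lieZr, lieZl) lie_lier lie_liel !scaler0 !addr0.
rewrite !scalerDr; set a := _ *: lie G h x; set b := _ *: lie G g h.
set c := _ *: lie G g x; rewrite !addrA [RHS]addrAC -!addrA.
do 2 congr (_ + _); rewrite [RHS]addrC -!addrA; congr (_ + _).
by rewrite [c + b]addrC.
Qed.

Lemma J_adj t (z z' : 'rV[R]_m) : dot (J t z) z' = dot (lie G (z, 0) (z', 0)).2 t.
Proof.
have -> : (z', 0) = \sum_(i < m) z' 0 i *: (e1 i : strat R m k).
  apply: injective_projections => /=.
    rewrite (raddf_sum (@fst _ _)) {1}(row_sum_delta z').
    by apply: eq_bigr => i _.
  rewrite (raddf_sum (@snd _ _)) big1 // => i _; exact: scaler0.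
rewrite lie_sumr /dot (raddf_sum (@snd _ _)).
under [RHS]eq_bigr => j _ do rewrite summxE mulr_suml.
rewrite exchange_big /=; apply: eq_bigr => i _.
rewrite mxE mulr_suml; apply: eq_bigr => j _.
by rewrite lieZr /= mxE mulrC mulrA.
Qed.

Lemma J_is_linear t : linear (J t).
Proof.
move=> a z z'; apply/rowP => i; rewrite !mxE /dot mulr_sumr -big_split /=.
have -> : (a *: z + z', 0) = a *: ((z, 0) : strat R m k) + (z', 0).
  by apply: injective_projections => //=; rewrite scaler0 addr0.
apply: eq_bigr => l _.
by rewrite lie_linearl /= !mxE mulrDl mulrA.
Qed.

HB.instance Definition _ t :=
  GRing.isLinear.Build R 'rV[R]_m 'rV[R]_m _ (J t) (J_is_linear t).

Lemma XE i u g : X i u g = 'D_(e1 i + 2^-1 *: lie G g (e1 i)) u g.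
Proof.
rewrite /X /derive; set p := (fun s => _); set q := (fun s => _).
suff -> : p = q by [].
apply/funext => s; rewrite /p /q /= gmulg1 /gid addr0 /gmul lieZr.
rewrite scalerA mulrC -scalerA -addrA -scalerDr.
by rewrite [g + _]addrC.
Qed.

Lemma X_coord i u g : differentiable u g ->
  X i u g = partial_z i u g
    + 2^-1 * \sum_(l < k) J (delta_mx 0 l) g.1 0 i * partial_t l u g.
Proof.
move=> du; rewrite XE /partial_z /partial_t !deriveE // linearD linearZ /=.
congr (_ + _ * _); rewrite lie_V1.
have -> : lie G (g.1, 0) (delta_mx 0 i, 0) =
    \sum_(l < k) J (delta_mx 0 l) g.1 0 i *: (e2 l : strat R m k).
  apply: injective_projections.
    rewrite lie_V1V1 //.
    by rewrite (raddf_sum (@fst _ _)) big1 // => l _; exact: scaler0.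
  rewrite (raddf_sum (@snd _ _)) [LHS]row_sum_delta.
  apply: eq_bigr => l _; congr (_ *: _).
  rewrite mxE /dot (bigD1 l) //= mxE !eqxx mulr1 big1 ?addr0 // => j jl.
  by rewrite mxE eqxx (negbTE jl) mulr0.
rewrite linear_sum; apply: eq_bigr => l _.
by rewrite linearZ /= deriveE.
Qed.

End Carnot.

(* Main.v *)
Require Import Defs.
From mathcomp Require Import all_boot all_order all_algebra.
From mathcomp Require Import all_classical all_reals all_analysis.
From mathcomp Require Import ring lra.
Import Order.TTheory GRing.Theory Num.Theory.
Import numFieldNormedType.Exports.
Local Open Scope classical_set_scope.
Local Open Scope ring_scope.

(** At a point [g = (z, t)], differentiating [rho^4 = |z|^4 + 16 |t|^2] gives
    [gradH rho = (|z|^2 z + 4 J(t) z) / rho^3].  Since [J(t) z] is orthogonal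
    to [z] and of norm [|t| |z|], [|gradH rho|^2 = |z|^2 / rho^2].  Polarizing
    the Heisenberg condition in [t] yields [[z, J(t) z] = |z|^2 t], so in
    [<gradH u, gradH rho>] the derivatives of [u] along [z] and [t] assemble to
    [Z u |z|^2 / rho^3] and only the derivative along [J(t) z] survives in the
    discrepancy. *)

Section EuclideanDot.
Context {R : realType} {n : nat}.
Implicit Types (a : R) (x y w : 'rV[R]_n).

Lemma dotC x y : dot x y = dot y x.
Proof. by apply: eq_bigr => i _; rewrite mulrC. Qed.

Lemma dotDl x y w : dot (x + y) w = dot x w + dot y w.
Proof.
by rewrite /dot -big_split; apply: eq_bigr => i _; rewrite mxE mulrDl.
Qed.

Lemma dotDr x y w : dot w (x + y) = dot w x + dot w y.
Proof. by rewrite dotC dotDl ![dot w _]dotC. Qed.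

Lemma dotZl a x y : dot (a *: x) y = a * dot x y.
Proof. by rewrite /dot mulr_sumr; apply: eq_bigr => i _; rewrite mxE mulrA. Qed.

Lemma dotZr a x y : dot x (a *: y) = a * dot x y.
Proof. by rewrite dotC dotZl dotC. Qed.

Lemma dot_delta x i : dot x (delta_mx 0 i) = x 0 i.
Proof.
rewrite /dot (bigD1 i) //= mxE !eqxx mulr1 big1 ?addr0 // => j ji.
by rewrite mxE eqxx (negbTE ji) mulr0.
Qed.

Lemma dot_ge0 x : 0 <= dot x x.
Proof. by apply: sumr_ge0 => i _; rewrite -expr2 sqr_ge0. Qed.

Lemma dot_eq0 x : (dot x x == 0) = (x == 0).
Proof.
apply/eqP/eqP => [x0|->]; last by rewrite -(scale0r 0) dotZl mul0r.
apply/rowP => i; rewrite mxE; apply/eqP; rewrite -sqrf_eq0 expr2.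
by move/psumr_eq0P: x0 => ->// j _; rewrite -expr2 sqr_ge0.
Qed.

Lemma dot_inj x y : (forall w, dot x w = dot y w) -> x = y.
Proof. by move=> xy; apply/rowP => i; rewrite -!dot_delta. Qed.

Lemma enorm_sqr x : enorm x ^+ 2 = dot x x.
Proof. exact/sqr_sqrtr/dot_ge0. Qed.

(** This makes [rho ^+ 4] along a line a polynomial in the parameter [a]. *)
Lemma dot_line a x y :
  dot (a *: y + x) (a *: y + x) = dot x x + 2 * dot x y * a + dot y y * a ^+ 2.
Proof. by rewrite !dotDl !dotDr !dotZl !dotZr (dotC y x); ring. Qed.

End EuclideanDot.

Section Strat.
Context {R : realType} {m k : nat}.
Implicit Types (c : 'rV[R]_m) (d : 'rV[R]_k) (g v : strat R m k).

Lemma sum_e1 c : (c, 0) = \sum_(i < m) c 0 i *: (e1 i : strat R m k).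
Proof.
apply: injective_projections.
  by rewrite (raddf_sum (@fst _ _)) [LHS]row_sum_delta.
by rewrite (raddf_sum (@snd _ _)) big1 // => i _; exact: scaler0.
Qed.

Lemma sum_e2 d : (0, d) = \sum_(l < k) d 0 l *: (e2 l : strat R m k).
Proof.
apply: injective_projections.
  by rewrite (raddf_sum (@fst _ _)) big1 // => l _; exact: scaler0.
by rewrite (raddf_sum (@snd _ _)) [LHS]row_sum_delta.
Qed.

(** Linearity of the differential: coordinate sums become values of ['d u g], where the final
    cancellation is carried out. *)
Lemma sum_partial_z (u : strat R m k -> R) g c : differentiable u g ->
  \sum_(i < m) c 0 i * partial_z i u g = 'd u g (c, 0).
Proof.
move=> du; rewrite sum_e1 linear_sum; apply: eq_bigr => i _.
by rewrite linearZ /partial_z deriveE.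
Qed.

Lemma sum_partial_t (u : strat R m k -> R) g d : differentiable u g ->
  \sum_(l < k) d 0 l * partial_t l u g = 'd u g (0, d).
Proof.
move=> du; rewrite sum_e2 linear_sum; apply: eq_bigr => l _.
by rewrite linearZ /partial_t deriveE.
Qed.

Lemma rhoE g : rho g = (dot g.1 g.1 ^+ 2 + 16 * dot g.2 g.2) `^ (4^-1).
Proof. by rewrite /rho -!enorm_sqr -exprM. Qed.

Lemma rho_base_gt0 g : g != 0 -> 0 < dot g.1 g.1 ^+ 2 + 16 * dot g.2 g.2.
Proof.
move=> g0; have z0 := dot_ge0 g.1; have t0 := dot_ge0 g.2.
rewrite lt0r addr_ge0 ?sqr_ge0 ?mulr_ge0 // andbT.
rewrite paddr_eq0 ?sqr_ge0 ?mulr_ge0 // sqrf_eq0 mulf_eq0 pnatr_eq0 /= !dot_eq0.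
by case: g g0 {z0 t0} => z t; rewrite -pair_eqE.
Qed.

Lemma rho_gt0 g : g != 0 -> 0 < rho g.
Proof. by move=> /rho_base_gt0 g0; rewrite rhoE powR_gt0. Qed.

Lemma rho_pow4 g : rho g ^+ 4 = dot g.1 g.1 ^+ 2 + 16 * dot g.2 g.2.
Proof.
rewrite rhoE -powR_mulrn ?powR_ge0 // -powRrM mulVf ?pnatr_eq0 // powRr1 //.
by rewrite addr_ge0 ?sqr_ge0 ?mulr_ge0 ?dot_ge0.
Qed.

(** Restricting to the line through [g] in direction [v] leaves the one-variable chain rule for the
    fourth root, valid because [rho ^+ 4] is positive at [g]. *)
Lemma derive_rho g v : g != 0 ->
  'D_v (@rho R m k) g =
    (dot g.1 g.1 * dot g.1 v.1 + 8 * dot g.2 v.2) / rho g ^+ 3.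
Proof.
move=> g0; have N0 := rho_base_gt0 _ g0.
(* On the line [g + s v], [rho ^+ 4] is the polynomial [p] in [s]. *)
pose q n (x y : 'rV[R]_n) : {poly R} :=
  (dot x x)%:P + (2 * dot x y) *: 'X + dot y y *: 'X^2.
pose p := q m g.1 v.1 ^+ 2 + 16 *: q k g.2 v.2.
have rho_line s : rho (s *: v + g) = p.[s] `^ (4^-1).
  by rewrite rhoE !dot_line /p /q !hornerE.
have p0 : p.[0] = dot g.1 g.1 ^+ 2 + 16 * dot g.2 g.2.
  by rewrite /p /q !hornerE /= !mulr0 !addr0.
have rho_derive1 :
    'D_v (@rho R m k) g = derive1 ((fun x : R => x `^ (4^-1)) \o horner p) 0.
  rewrite /derive1 /derive; set q1 := (fun h => _); set q2 := (fun h => _).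
  suff -> : q1 = q2 by [].
  apply/funext => s; rewrite /q1 /q2 /= rho_line addr0 -(rho_line 0).
  by rewrite scale0r add0r.
have dpow : is_derive p.[0] 1 (fun x : R => x `^ (4^-1))
    (4^-1 * p.[0] `^ (4^-1 - 1)).
  by apply: is_derive1_powR; rewrite p0.
have dp : is_derive (0 : R) 1 (horner p)
    (4 * (dot g.1 g.1 * dot g.1 v.1 + 8 * dot g.2 v.2)).
  by apply: is_derive_eq; rewrite /p /q !poly.derivE !hornerE /=; ring.
have := is_derive1_comp dpow dp; rewrite rho_derive1 derive1E => -[_ ->].
(* Here [p.[0]] is [rho g ^+ 4], so its power -3/4 is the inverse of [rho g ^+ 3]. *)
have -> : p.[0] `^ (4^-1 - 1) = (rho g ^+ 3)^-1.
  have r0 := rho_gt0 _ g0.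
  apply: (mulIf (expf_neq0 3 (lt0r_neq0 r0))).
  rewrite mulVf ?expf_neq0 ?gt_eqF //.
  rewrite rhoE -p0 -powR_mulrn ?powR_ge0 // -powRrM -powRD; last first.
    by rewrite p0 (gt_eqF N0) implybT.
  by rewrite (_ : 4^-1 - 1 + _ = 0) ?powRr0 //; field.
by field; rewrite gt_eqF ?rho_gt0.
Qed.

End Strat.

Section HeisenbergType.
Context {R : realType} {m k : nat} (G : carnot2 R m k).
Implicit Types (c z : 'rV[R]_m) (s t : 'rV[R]_k) (g : strat R m k).

Lemma J_entry t z i :
  J G t z 0 i = \sum_(l < k) t 0 l * J G (delta_mx 0 l) z 0 i.
Proof.
by rewrite mxE; apply: eq_bigr => l _; rewrite mxE dot_delta mulrC.
Qed.

Lemma JD s t z : J G (s + t) z = J G s z + J G t z.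
Proof. by apply/rowP => i; rewrite !mxE dotDr. Qed.

Lemma JZ a t z : J G (a *: t) z = a *: J G t z.
Proof. by apply/rowP => i; rewrite !mxE dotZr. Qed.

Lemma dot_J_self t z : dot (J G t z) z = 0.
Proof. by rewrite J_adj lie_alt -(scale0r 0) dotZl mul0r. Qed.

(** Since [J] is linear in [t], the fields [Theta] weighted by the coordinates of [t] add up to the
    derivative along [J(t) z]. *)
Lemma sum_Theta (u : strat R m k -> R) g : differentiable u g ->
  \sum_(l < k) g.2 0 l * Theta G l u g = 'd u g (J G g.2 g.1, 0).
Proof.
move=> du; rewrite -sum_partial_z //.
under eq_bigr do rewrite mulr_sumr.
rewrite exchange_big; apply: eq_bigr => i _ /=.
by rewrite J_entry mulr_suml; apply: eq_bigr => l _; rewrite mulrA.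
Qed.

(** By linearity of the bracket and of the differential, pairing with [c] differentiates [u] along
    the left-invariant field determined by [c]. *)
Lemma dot_gradH (u : strat R m k -> R) g c : differentiable u g ->
  dot (gradH G u g) c = 'd u g ((c, 0) + 2^-1 *: lie G g (c, 0)).
Proof.
move=> du; rewrite sum_e1 lie_sumr scaler_sumr -big_split linear_sum.
apply: eq_bigr => i _ /=.
rewrite lieZr scalerA mulrC [2^-1 * _]mulrC -scalerA -scalerDr linearZ /=.
by rewrite mxE XE deriveE.
Qed.

Lemma gradH_rho g : g != 0 ->
  gradH G (@rho R m k) g =
    (rho g ^+ 3)^-1 *: (dot g.1 g.1 *: g.1 + 4 *: J G g.2 g.1).
Proof.
move=> g0; apply/rowP => i; rewrite mxE XE derive_rho // lie_V1.
(* The bracket [[z, e_i]] is vertical, so it enters only the [t] term of [derive_rho], where 8 times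
   1/2 gives the coefficient 4. *)
rewrite /= lie_V1V1 // scaler0 addr0 add0r dot_delta dotZr !mxE [dot g.2 _]dotC.
by rewrite -/(e1 i); field; rewrite gt_eqF ?rho_gt0.
Qed.

Context (hG : Heisenberg_type G).

(** The hypothesis is the case of unit [t]; the rest follows by rescaling, with [t = 0] treated
    apart. *)
Lemma dot_J_sqr t z : dot (J G t z) (J G t z) = dot t t * dot z z.
Proof.
have [->|t0] := eqVneq t 0.
  by rewrite -(scale0r 0) JZ !dotZl !mul0r.
have n0 : enorm t != 0 by rewrite -sqrf_eq0 enorm_sqr dot_eq0.
have n1 : enorm ((enorm t)^-1 *: t) = 1.
  by rewrite {1}/enorm dotZl dotZr -enorm_sqr expr2 mulKf // mulVf // sqrtr1.
by rewrite -(hG _ n1 z z) JZ dotZl dotZr -(enorm_sqr t); field.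
Qed.

Lemma dot_JJ s t z : dot (J G s z) (J G t z) = dot s t * dot z z.
Proof.
have := dot_J_sqr (s + t) z.
rewrite JD !dotDl !dotDr !dot_J_sqr (dotC (J G t z)) (dotC t s); lra.
Qed.

(** Pairing the vertical part with any [s] gives [<J(s) z, J(t) z> = <s, t> |z|^2]. *)
Lemma lie_J t z : lie G (z, 0) (J G t z, 0) = (0, dot z z *: t).
Proof.
apply: injective_projections => /=; first by rewrite lie_V1V1.
by apply: dot_inj => s; rewrite -J_adj dot_JJ dotZl mulrC (dotC s).
Qed.

Lemma enorm_gradH_rho g : g != 0 ->
  enorm (gradH G (@rho R m k) g) ^+ 2 = dot g.1 g.1 / rho g ^+ 2.
Proof.
move=> g0; rewrite enorm_sqr gradH_rho //.
rewrite dotZl dotZr !dotDl !dotDr !dotZl !dotZr.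
rewrite (dotC g.1) dot_J_self dot_J_sqr; have r4 := rho_pow4 g.
have r0 : rho g != 0 by rewrite gt_eqF ?rho_gt0.
(* The cross terms vanish, and the numerator [|z|^6 + 16 |t|^2 |z|^2] factors as [|z|^2 rho^4]. *)
transitivity (dot g.1 g.1 * rho g ^+ 4 / rho g ^+ 6); last by field.
by rewrite r4; field.
Qed.

Lemma discrepancyE (u : strat R m k -> R) g : differentiable u g -> g != 0 ->
  discrepancy G u g =
    4 / rho g ^+ 3 * \sum_(l < k) g.2 0 l * Theta G l u g.
Proof.
move=> du g0; rewrite sum_Theta // /discrepancy enorm_gradH_rho // gradH_rho //.
rewrite dotZr dotDr !dotZr !dot_gradH // !(lie_V1 _ g) /= lie_alt lie_J.
rewrite /Z sum_partial_z // sum_partial_t // scaler0 addr0 linearD linearZ /=.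
have -> : (0, dot g.1 g.1 *: g.2) = dot g.1 g.1 *: ((0, g.2) : strat R m k).
  by apply: injective_projections => //=; rewrite scaler0.
(* The factor 4 times the 1/2 of the group law gives the 2 in front of the [t] part of [Z], so the
   [Z u] terms cancel. *)
rewrite linearZ /= /GRing.scale /=; field.
by rewrite gt_eqF ?rho_gt0.
Qed.

End HeisenbergType.

Theorem lemma9p8 (R : realType) (m k : nat) (G : carnot2 R m k)
    (hG : Heisenberg_type G) (u : strat R m k -> R) (hu : C1 u) :
  (forall g : strat R m k, g != gid ->
     discrepancy G u g =
       4 / rho g ^+ 3 * \sum_(l < k) g.2 0 l * Theta G l u g)
  /\
  ((forall g : strat R m k, g != gid -> discrepancy G u g = 0) <->
   (forall g : strat R m k, \sum_(l < k) g.2 0 l * Theta G l u g = 0)).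
Proof.
have [du _] := hu.
have E g : g != gid -> discrepancy G u g =
    4 / rho g ^+ 3 * \sum_(l < k) g.2 0 l * Theta G l u g.
  exact: (discrepancyE _ hG _ _ (du g)).
split=> //; split=> [Eu0 g|Th0 g g0]; last by rewrite E // Th0 mulr0.
(* Vanishing discrepancy says nothing at the identity, but there [t = 0] and the sum is trivially
   zero. *)
have [->|g0] := eqVneq g gid.
  by rewrite big1 // => l _; rewrite mxE mul0r.
apply/eqP; move/eqP: (Eu0 g g0); rewrite E // mulf_eq0 => /orP[|//].
by rewrite mulf_eq0 invr_eq0 expf_eq0 pnatr_eq0 (gt_eqF (rho_gt0 _ g0)).
Qed.
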